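(* The following statements (T1)–(T4) are true in every infinite first-order structure $\mathfrak{M}$ with domain $M$, and (T7) holds in the structure $\mathcal{R}$. For every infinite structure $\mathfrak{M}$, all elements $a,b,c\in M$ and all finite tuples $\overline{b},\overline{c}$ of elements of $M$: (T1) (Existence) for every finite tuple $\overline{y}$ of elements of $M$ there is $x\in M$ with $\mathsf{Tp}(x,\overline{y})$; in particular, there exists $a\in M$ such that $\mathsf{Tp}(a)$; (T2) (Downward monotonicity) $\mathsf{Tp}(a,c\overline{b})\Rightarrow\mathsf{Tp}(a,\overline{b})$; (T3) (Parameters act as a set rather than a vector) (a) $\mathsf{Tp}(a,\overline{b})\Rightarrow\mathsf{Tp}(a,\pi\overline{b})$ for any permutation $\pi\overline{b}$ of the tuple $\overline{b}$; and (b) $\mathsf{Tp}(a,b\overline{c})\Rightarrow\mathsf{Tp}(a,bb\overline{c})$; (T4) (Irreflexivity) $\mathsf{Tp}(a,b)\Rightarrow a\neq b$. In the structure $\mathcal{R}$: (T7) (Tailset) for any finite tuple $\overline{c}$ of reals, the set $\{x\in\mathcal{P}(\omega):\mathsf{Tp}(x,\overline{c})\}$ is a tailset.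
   Context: Let $L$ be a first-order language, $\mathfrak{M}$ an infinite $L$-structure with domain $M$, $a\in M$ and $\overline{b}$ a finite tuple from $M$. A property $\phi(x,\overline{b})$ (an $L$-formula with one free variable $x$ and parameters from $\overline{b}$) is $\overline{b}$-typical if its extension $X=\{m\in M:\mathfrak{M}\models\phi(m,\overline{b})\}$ satisfies $|X|>|M\setminus X|$, equivalently $|M\setminus X|<|M|$. $\mathsf{Tp}(a,\overline{b})$ (''$a$ is $\overline{b}$-typical'') means that $a$ satisfies every $\overline{b}$-typical property; equivalently, for every $L$-formula $\phi(x,\overline{y})$ with $\mathfrak{M}\models\phi(a,\overline{b})$, the set $\{m\in M:\mathfrak{M}\models\phi(m,\overline{b})\}$ has cardinality $|M|$. $\mathsf{Tp}(a)$ means $\mathsf{Tp}(a,\emptyset)$, i.e. with no parameters. Juxtaposition such as $c\overline{b}$ or $bb\overline{c}$ denotes concatenation of tuples. Reals are elements of $\mathcal{P}(\omega)$. $\mathcal{R}=(\omega,\mathcal{P}(\omega),+,\cdot,<,\in,0,1)$ is the full standard model of second-order arithmetic, in the language $L_2=\{+,\cdot,<,\in,0,1\}$ with variables for numbers and variables for reals. In $\mathcal{R}$, for reals $a$ and $\overline{b}$, $\mathsf{Tp}(a,\overline{b})$ means: for every $L_2$-formula $\phi(x,\overline{y})$ (with $x$, $\overline{y}$ ranging over reals) such that $\mathcal{R}\models\phi(a,\overline{b})$, $|\{x\in\mathcal{P}(\omega):\mathcal{R}\models\phi(x,\overline{b})\}|=2^{\aleph_0}$. For reals $a,b$, write $a\approx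 b$ if the symmetric difference $a\triangle b$ is finite. A set $X$ of reals is a tailset if $a\in X$ and $b\approx a$ imply $b\in X$.
   Formalization: (T1) is false for some infinite structures, e.g. (ω,+,·,<,0,1), where every ''x ≠ n'' is typical; existence, including the ''in particular'' clause, is stated only when the cofinality of |M| exceeds max(|L|, ℵ0). (T2)–(T4) and (T7) are as stated. *)

(* Defs.v *)
From mathcomp Require Import all_boot all_fingroup.
From mathcomp Require Import boolp classical_sets functions cardinality.

Set Implicit Arguments.
Unset Strict Implicit.
Unset Printing Implicit Defensive.

Local Open Scope classical_set_scope.
Local Open Scope card_scope.

Definition card_lt (T U : Type) (A : set T) (B : set U) : Prop :=
  (A #<= B) /\ ~ (B #<= A).

(** First-order languages (constants are the function symbols of arity 0),
    structures and formulas with equality.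

    Syntax is well scoped: [formula L n] is the type of formulas whose free
    variables are among the de Bruijn indices 0, ..., n-1.  [All] binds the
    index 0 of its body, and an assignment of the free variables is a tuple.
    The logic is read classically, so [Fls], [Imp] and [All] define the other
    connectives and the existential quantifier. *)

Record language : Type := Language {
  fsym : Type;
  fun_arity : fsym -> nat;
  rsym : Type;
  rel_arity : rsym -> nat }.

Record structure (L : language) : Type := Structure {
  dom :> Type;
  fun_interp : forall f : fsym L, ('I_(fun_arity f) -> dom) -> dom;
  rel_interp : forall r : rsym L, ('I_(rel_arity r) -> dom) -> Prop }.

Inductive term (L : language) (n : nat) : Type :=
| Var of 'I_n
| App (f : fsym L) of ('I_(fun_arity f) -> term L n).

Inductive formula (L : language) : nat -> Type :=
| Fls n : formula L n
| Eq n of term L n & term L n : formula L n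
| Rel n (r : rsym L) of ('I_(rel_arity r) -> term L n) : formula L n
| Imp n of formula L n & formula L n : formula L n
| All n of formula L n.+1 : formula L n.

Section Semantics.
Variables (L : language) (M : structure L).

Fixpoint teval n (v : n.-tuple M) (t : term L n) : M :=
  match t with
  | Var i => tnth v i
  | App f ts => fun_interp (fun i => teval v (ts i))
  end.

Fixpoint sat n (phi : formula L n) : n.-tuple M -> Prop :=
  match phi in formula _ n return n.-tuple M -> Prop with
  | Fls _ => fun=> False
  | Eq _ s t => fun v => teval v s = teval v t
  | Rel _ r ts => fun v => rel_interp (fun i => teval v (ts i))
  | Imp _ phi psi => fun v => sat phi v -> sat psi v
  | All _ phi => fun v => forall x : M, sat phi (cons_tuple x v)
  end.

(** In [phi : formula L n.+1] the index 0 plays the role of x and the indices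
    1, ..., n that of the parameters. *)
Definition extension n (phi : formula L n.+1) (b : n.-tuple M) : set M :=
  [set m | sat phi (cons_tuple m b)].

Definition typical_property n (phi : formula L n.+1) (b : n.-tuple M) : Prop :=
  card_lt (~` extension phi b) (extension phi b).

Definition Tp (a : M) n (b : n.-tuple M) : Prop :=
  forall phi : formula L n.+1, typical_property phi b -> extension phi b a.

End Semantics.

(** [cofinality_gt T I]: for infinite [T], cf(|T|) > |I|, i.e. [T] is not the
    union of [I]-many subsets of cardinality less than |T|. *)
Definition cofinality_gt (T I : Type) : Prop :=
  forall F : I -> set T,
    (forall i, card_lt (F i) [set: T]) -> \bigcup_i F i <> [set: T].

(** A type of cardinality max(|L|, aleph_0), |L| being the number of
    nonlogical symbols of [L]. *)
Definition language_size (L : language) : Type := (fsym L + rsym L + nat)%type.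

(** Second-order arithmetic.  [formula2 p q] is the type of L_2-formulas with
    [p] free number variables and [q] free real variables, with de Bruijn
    indices counted separately in each sort. *)

Definition real : Type := set nat.

Inductive term2 (p : nat) : Type :=
| NVar of 'I_p
| NZero
| NOne
| NAdd of term2 p & term2 p
| NMul of term2 p & term2 p.

Inductive formula2 : nat -> nat -> Type :=
| Fls2 p q : formula2 p q
| EqN2 p q of term2 p & term2 p : formula2 p q
| EqR2 p q of 'I_q & 'I_q : formula2 p q
| Lt2 p q of term2 p & term2 p : formula2 p q
| In2 p q of term2 p & 'I_q : formula2 p q
| Imp2 p q of formula2 p q & formula2 p q : formula2 p q
| AllN2 p q of formula2 p.+1 q : formula2 p q
| AllR2 p q of formula2 p q.+1 : formula2 p q.

Fixpoint teval2 p (v : p.-tuple nat) (t : term2 p) : nat :=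
  match t with
  | NVar i => tnth v i
  | NZero => 0
  | NOne => 1
  | NAdd s t => teval2 v s + teval2 v t
  | NMul s t => teval2 v s * teval2 v t
  end.

(** Satisfaction in the full standard model: real quantifiers range over all
    of P(omega). *)
Fixpoint sat2 p q (phi : formula2 p q) :
    p.-tuple nat -> q.-tuple real -> Prop :=
  match phi in formula2 p q return p.-tuple nat -> q.-tuple real -> Prop with
  | Fls2 _ _ => fun _ _ => False
  | EqN2 _ _ s t => fun v _ => teval2 v s = teval2 v t
  | EqR2 _ _ i j => fun _ w => tnth w i = tnth w j
  | Lt2 _ _ s t => fun v _ => teval2 v s < teval2 v t
  | In2 _ _ t i => fun v w => tnth w i (teval2 v t)
  | Imp2 _ _ phi psi => fun v w => sat2 phi v w -> sat2 psi v w
  | AllN2 _ _ phi => fun v w => forall k : nat, sat2 phi (cons_tuple k v) w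
  | AllR2 _ _ phi => fun v w => forall x : real, sat2 phi v (cons_tuple x w)
  end.

Definition extension2 q (phi : formula2 0 q.+1) (b : q.-tuple real) :
    set real :=
  [set x | sat2 phi (nil_tuple nat) (cons_tuple x b)].

Definition Tp2 (a : real) q (b : q.-tuple real) : Prop :=
  forall phi : formula2 0 q.+1,
    extension2 phi b a -> extension2 phi b #= [set: real].

Definition almost_equal (a b : real) : Prop := finite_set (a `+` b).

Definition tailset (X : set real) : Prop :=
  forall a b : real, X a -> almost_equal b a -> X b.

(* Main.v *)
Require Import Defs.
From mathcomp Require Import all_boot all_fingroup.
From mathcomp Require Import boolp classical_sets functions cardinality.

Set Implicit Arguments.
Unset Strict Implicit.
Unset Printing Implicit Defensive.

Local Open Scope classical_set_scope.

(** Existence.  The elements that are not typical over a tuple y form the union,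
    over all formulas phi whose extension is typical, of the complements of
    these extensions, and each complement has cardinality less than |M|.  So it
    suffices that there are too few formulas for such a union to exhaust M.  The
    cofinality hypothesis counts symbols rather than formulas, and the usual
    bridge is that a language of infinite size kappa has kappa formulas.  The
    cardinal arithmetic behind it is avoided by working directly with the
    property that matters: a set A is [few] when every A-indexed union of sets
    smaller than M is again smaller than M.  If M is not an I-indexed union of
    smaller sets, then I is few ([few_cofinality]): a union of size |M| would
    carry a copy of M, on which its pieces trace a forbidden cover.  Being few
    passes to images and to unions over few index sets, hence to finite powers;
    as the syntax is generated by finitary constructors in countably many
    stages, the set of all formulas is few ([few_formula]).

    Dependence on the parameters.  If every entry of a tuple occurs in b, then a
    property with parameters in that tuple is a property with parameters in b,
    by renaming variables.  Dropping, permuting and repeating parameters are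
    three instances of this ([Tp_reindex]).

    Irreflexivity.  As M is infinite, being different from b is a typical
    property over b.

    Tailset.  Write + for symmetric difference and let b = a + d with d finite.
    A finite set of numbers is definable without parameters, so a formula phi
    true of b translates into a formula expressing phi(x + d), which is true of
    a ([extension2_shift]).  The latter has continuum many solutions, and the
    involution sending x to x + d maps them bijectively onto those of phi. *)

(** * Renaming free variables *)

(** The action of a renaming under a binder, which owns the index 0. *)
Definition lift_var n m (r : 'I_n -> 'I_m) (i : 'I_n.+1) : 'I_m.+1 :=
  if unlift ord0 i is Some j then lift ord0 (r j) else ord0.

Lemma reindex_cons (T : Type) n m (r : 'I_n -> 'I_m) (x : T) (v : m.-tuple T) :
  [tuple tnth (cons_tuple x v) (lift_var r i) | i < n.+1] =
  cons_tuple x [tuple tnth v (r i) | i < n].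
Proof.
apply: eq_from_tnth => i; rewrite tnth_mktuple /lift_var.
case: unliftP => [j ->|->]; last by rewrite !tnth0.
by rewrite !tnthS tnth_mktuple.
Qed.

Lemma reindex_behead (T : Type) n (x : T) (v : n.-tuple T) :
  [tuple tnth (cons_tuple x v) (lift ord0 i) | i < n] = v.
Proof. by apply: eq_from_tnth => i; rewrite tnth_mktuple tnthS. Qed.

Section RenameFirstOrder.
Variable L : language.

Fixpoint rename_term n m (r : 'I_n -> 'I_m) (t : term L n) : term L m :=
  match t with
  | Var i => Var L (r i)
  | App f ts => App (fun i => rename_term r (ts i))
  end.

Fixpoint rename n (phi : formula L n) :
    forall m, ('I_n -> 'I_m) -> formula L m :=
  match phi in formula _ n return forall m, ('I_n -> 'I_m) -> formula L m with
  | Fls _ => fun m _ => Fls L m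
  | Eq _ s t => fun m r => Eq (rename_term r s) (rename_term r t)
  | Rel _ R ts => fun m r => Rel (fun i => rename_term r (ts i))
  | Imp _ phi psi => fun m r => Imp (rename phi r) (rename psi r)
  | All _ phi => fun m r => All (rename phi (lift_var r))
  end.

Variable M : structure L.

Lemma teval_rename n m (r : 'I_n -> 'I_m) (t : term L n) (v : m.-tuple M) :
  teval v (rename_term r t) = teval [tuple tnth v (r i) | i < n] t.
Proof.
elim: t => [i|f ts IH] /=; first by rewrite tnth_mktuple.
by congr fun_interp; apply/funext => i; exact: IH.
Qed.

Lemma sat_rename n (phi : formula L n) m (r : 'I_n -> 'I_m) (v : m.-tuple M) :
  sat (rename phi r) v = sat phi [tuple tnth v (r i) | i < n].
Proof.
elim: phi m r v => {n} [n|n s t|n R ts|n p IHp q IHq|n p IHp] m r v //=.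
- by rewrite !teval_rename.
- by congr rel_interp; apply/funext => i; rewrite teval_rename.
- by rewrite IHp IHq.
- by apply: eq_forall => x; rewrite IHp reindex_cons.
Qed.

(** An extension over the reindexed tuple is also an extension over [b], that
    of the renamed formula, so it is typical over both or over neither. *)
Lemma Tp_reindex (a : M) n m (r : 'I_n -> 'I_m) (b : m.-tuple M) :
  Tp a b -> Tp a [tuple tnth b (r i) | i < n].
Proof.
move=> Ha phi; rewrite /typical_property.
have <- : extension (rename phi (lift_var r)) b =
          extension phi [tuple tnth b (r i) | i < n].
  by apply/funext => x; rewrite /extension /mkset sat_rename reindex_cons.
exact: Ha.
Qed.

End RenameFirstOrder.

(** * Index sets with small unions *)

Section Few.
Local Open Scope card_scope.

Lemma injective_card_leT (T : Type) (A : set T) :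
  [set: T] #<= A <-> exists2 f : T -> T, injective f & forall x, A (f x).
Proof.
elim/Ppointed: T => T in A *.
  rewrite !emptyE_subdef; split=> // _.
  by exists id => // x; have := no x.
split=> [/pcard_leP/injfunPex[f fA f_inj]|[f f_inj fA]].
  by exists f => [x y /f_inj|x]; [rewrite !inE; exact|exact: fA].
by apply/pcard_leP/injfunPex; exists f => [x _|x y _ _ /f_inj]; first exact: fA.
Qed.

Lemma card_lt_setT (T : Type) (A : set T) :
  card_lt A [set: T] <-> ~ ([set: T] #<= A).
Proof. by split=> [[]//|nTA]; split=> //; exact: card_leT. Qed.

Variable M : Type.
Hypothesis M_neq0 : [set: M] !=set0.

(** Closure under unions over few index sets is immediate because the union is
    required to be small, and not merely different from M.  A record, so that
    unification does not see through it to the underlying product. *)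
Record few (X : Type) (A : set X) : Prop := Few {
  few_union (F : X -> set M) : (forall x, A x -> ~ ([set: M] #<= F x)) ->
    ~ ([set: M] #<= \bigcup_(x in A) F x) }.

(** If the union of the [F i] were as large as M, it would contain the range of
    an injection f of M into itself, and the preimages under f of the [F i]
    would be smaller sets covering M. *)
Lemma few_cofinality (I : Type) : cofinality_gt M I -> few [set: I].
Proof.
move=> cofI; split=> F smallF /injective_card_leT[f f_inj fU].
apply: (cofI (fun i => f @^-1` F i)) => [i|].
  apply/card_lt_setT => /injective_card_leT[g g_inj gF].
  apply: (smallF i) => //; apply/injective_card_leT.
  by exists (f \o g) => //; exact: inj_comp.
by apply/seteqP; split=> // m _; have [i _ Fi] := fU m; exists i.
Qed.

Lemma few_sub (X : Type) (A B : set X) : few B -> A `<=` B -> few A.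
Proof.
move=> fewB AB; split=> F smallF.
(* Outside A the sets F x may be large and are replaced by the empty set. *)
pose G x := [set m | A x /\ F x m].
have -> : \bigcup_(x in A) F x = \bigcup_(x in B) G x.
  apply/seteqP; split=> m [x]; first by exists x; [exact: AB|].
  by move=> _ [Ax Fx]; exists x.
apply: (few_union fewB) => x _ /injective_card_leT[g g_inj gG].
have [m _] := M_neq0; have [Ax _] := gG m.
apply: (smallF x Ax); apply/injective_card_leT.
by exists g => // y; case: (gG y).
Qed.

Lemma few_image (X Y : Type) (f : X -> Y) (A : set X) : few A -> few (f @` A).
Proof.
move=> fewA; split=> F smallF; rewrite bigcup_image.
by apply: (few_union fewA (F := F \o f)) => x Ax; apply: smallF; exists x.
Qed.

Lemma few_bigcup (I X : Type) (A : set I) (B : I -> set X) :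
  few A -> (forall i, A i -> few (B i)) -> few (\bigcup_(i in A) B i).
Proof.
move=> fewA fewB; split=> F smallF; rewrite bigcup_bigcup.
apply: (few_union fewA) => i Ai; apply: (few_union (fewB i Ai)) => x Bx.
by apply: smallF; exists i.
Qed.

Lemma few_set1 (X : Type) (x : X) : few [set x].
Proof. by split=> F smallF; rewrite bigcup_set1; exact: smallF. Qed.

Lemma few_set0 (X : Type) : few (@set0 X).
Proof.
split=> F _; rewrite bigcup_set0 => /injective_card_leT[f _ f0].
by have [m _] := M_neq0; exact: f0 m.
Qed.

(** Symbols embed into the sum of all symbols and numbers, but need not be an
    image of it, as a language may have no symbol of one kind.  Each fibre of
    the embedding has at most one element. *)
Lemma few_preimage (X Y : Type) (f : X -> Y) (A : set Y) :
  injective f -> few A -> few (f @^-1` A).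
Proof.
move=> f_inj fewA.
have -> : f @^-1` A = \bigcup_(y in A) (f @^-1` [set y]).
  by apply/seteqP; split=> x => [Ax|[y Ay /= ->//]]; exists (f x).
apply: few_bigcup => // y _.
have [[x fx]|noy] := pselect (exists x, f x = y).
  apply: (few_sub (few_set1 x)) => x' fx'.
  by apply: f_inj; rewrite fx; exact: fx'.
by apply: (few_sub (few_set0 _)) => x fx; apply: noy; exists x.
Qed.

Hypothesis few_nat : few [set: nat].

Lemma few_countable (X : Type) (B : nat -> set X) :
  (forall d, few (B d)) -> few (\bigcup_d B d).
Proof. by move=> fewB; apply: few_bigcup. Qed.

Lemma few_setU (X : Type) (A B : set X) : few A -> few B -> few (A `|` B).
Proof.
move=> fewA fewB.
apply: (few_sub (few_countable (B := fun d => if d is 0 then A else B) _)).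
  by case.
by move=> x [Ax|Bx]; [exists 0|exists 1].
Qed.

Lemma few_ord n : few [set: 'I_n].
Proof. exact: (few_preimage (@ord_inj n) few_nat). Qed.

Lemma few_fun (X : Type) (A : set X) k :
  few A -> few [set h : 'I_k -> X | forall i, A (h i)].
Proof.
move=> fewA; elim: k => [|k IH].
  have [[h0]|no] := pselect (inhabited ('I_0 -> X)); last first.
    by apply: (few_sub (few_set0 _)) => h _; apply: no; exists.
  by apply: (few_sub (few_set1 h0)) => h _; apply/funext => -[].
pose cons x (h : 'I_k -> X) (i : 'I_k.+1) :=
  if unlift ord0 i is Some j then h j else x.
apply: (few_sub (few_bigcup (B := fun x => cons x @` _) fewA
          (fun x _ => few_image (cons x) IH))) => h Ah.
exists (h ord0) => //; exists (h \o lift ord0) => [i|]; first exact: Ah.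
by apply/funext => i; rewrite /cons; case: unliftP => [j|] ->.
Qed.

End Few.

(** * There are few formulas *)

Section FewFormulas.
Variables (L : language) (M : Type).
Hypothesis M_neq0 : [set: M] !=set0.
Hypothesis cofM : cofinality_gt M (language_size L).

Let few_symbols := few_cofinality cofM.

Let few_fsym : few M [set: Defs.fsym L].
Proof.
pose f s : language_size L := inl (inl s).
by apply: (few_preimage M_neq0 (f := f) _ few_symbols) => ? ? [].
Qed.

Let few_rsym : few M [set: rsym L].
Proof.
pose f R : language_size L := inl (inr R).
by apply: (few_preimage M_neq0 (f := f) _ few_symbols) => ? ? [].
Qed.

Let few_nat : few M [set: nat].
Proof.
pose f k : language_size L := inr k.
by apply: (few_preimage M_neq0 (f := f) _ few_symbols) => ? ? [].
Qed.

Fixpoint terms_upto n d : set (term L n) :=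
  if d is d'.+1 then
    range (@Var L n) `|`
    \bigcup_f (@App L n f @` [set ts | forall i, @terms_upto n d' (ts i)])
  else set0.
Arguments terms_upto : clear implicits.

Lemma few_terms_upto n d : few M (terms_upto n d).
Proof.
elim: d => [|d IH] /=; first exact: few_set0.
apply: few_setU => //; first exact/few_image/few_ord.
by apply: few_bigcup => // f _; apply/few_image/few_fun.
Qed.

Lemma terms_upto_mono n d e : d <= e -> terms_upto n d `<=` terms_upto n e.
Proof.
elim: d e => [|d IH] e; first by move=> _ t [].
case: e => //= e de t [[i _ <-]|[f _ [ts uts <-]]].
  by left; exists i.
by right; exists f => //; exists ts => // i; exact: (IH e) (uts i).
Qed.

(** Arities are finite, so the stages at which the arguments of a symbol appear
    have a maximum. *)
Lemma in_terms_upto n (t : term L n) : exists d, terms_upto n d t.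
Proof.
elim: t => [i|f ts /choice[d td]]; first by exists 1; left; exists i.
exists (\max_i d i).+1; right; exists f => //; exists ts => // i.
exact: terms_upto_mono (leq_bigmax i) _ (td i).
Qed.

Lemma few_term n : few M [set: term L n].
Proof.
apply: (few_sub M_neq0 (few_countable few_nat (few_terms_upto n))) => t _.
by have [d] := in_terms_upto t; exists d.
Qed.

Fixpoint formulas_upto d n : set (formula L n) :=
  if d is d'.+1 then
    [set Fls L n] `|`
    \bigcup_s (@Eq L n s @` setT) `|`
    \bigcup_R (@Rel L n R @` setT) `|`
    \bigcup_(p in @formulas_upto d' n) (@Imp L n p @` @formulas_upto d' n) `|`
    @All L n @` @formulas_upto d' n.+1
  else set0.
Arguments formulas_upto : clear implicits.

Lemma few_formulas_upto d n : few M (formulas_upto d n).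
Proof.
elim: d n => [|d IH] n /=; first exact: few_set0.
do 4?[apply: few_setU => //]; first exact: few_set1.
- by apply: few_bigcup (few_term n) _ => s _; apply/few_image/few_term.
- apply: few_bigcup few_rsym _ => R _; apply: few_image.
  apply: (few_sub M_neq0 (few_fun M_neq0 _ (few_term n))).
  by move=> ts _ i.
- by apply: few_bigcup => // p _; exact: few_image.
- exact: few_image.
Qed.

Lemma formulas_upto_mono n d e :
  d <= e -> formulas_upto d n `<=` formulas_upto e n.
Proof.
elim: d n e => [|d IH] n e; first by move=> _ phi [].
case: e => //= e de phi [[[[->|?]|?]|[p up [q uq <-]]]|[p up <-]].
- by do 4!left.
- by do 3!left; right.
- by do 2!left; right.
- by left; right; exists p; [exact: IH up|exists q => //; exact: IH uq].
- by right; exists p => //; exact: IH up.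
Qed.

Lemma in_formulas_upto n (phi : formula L n) : exists d, formulas_upto d n phi.
Proof.
elim: phi => {n} [n|n s t|n R ts|n p [d pd] q [e qe]|n p [d pd]].
- by exists 1; do 4!left.
- by exists 1; do 3!left; right; exists s => //; exists t.
- by exists 1; do 2!left; right; exists R => //; exists ts.
- exists (maxn d e).+1; left; right; exists p.
    exact: formulas_upto_mono (leq_maxl d e) _ pd.
  by exists q => //; exact: formulas_upto_mono (leq_maxr d e) _ qe.
- by exists d.+1; right; exists p.
Qed.

Lemma few_formula n : few M [set: formula L n].
Proof.
have few_upto d : few M (formulas_upto d n) := few_formulas_upto d n.
apply: (few_sub M_neq0 (few_countable few_nat few_upto)) => phi _.
by have [d] := in_formulas_upto phi; exists d.
Qed.

End FewFormulas.

(** * Typical elements of a structure *)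

Section Typical.
Local Open Scope card_scope.
Variables (L : language) (M : structure L).
Hypothesis M_infinite : infinite_set [set: M].

Lemma exists_Tp n (y : n.-tuple M) :
  cofinality_gt M (language_size L) -> exists x : M, Tp x y.
Proof.
move=> cofM.
have M_neq0 : [set: M] !=set0 := infinite_setN0 M_infinite.
pose atypical phi := [set m | typical_property phi y /\ ~ extension phi y m].
apply: contrapT => noTp.
apply: (few_union (few_formula M_neq0 cofM n.+1) (F := atypical)).
  move=> phi _ /injective_card_leT[f f_inj fA].
  have [m _] := M_neq0; have [[_ +] _] := fA m; apply.
  apply: (card_le_trans (card_leT _)); apply/injective_card_leT.
  by exists f => // x; case: (fA x).
suff -> : \bigcup_phi atypical phi = [set: M] by [].
apply/seteqP; split=> // m _; apply: contrapT => no_phi.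
apply: noTp; exists m => phi phi_typ; apply: contrapT => not_phi.
by apply: no_phi; exists phi.
Qed.

Lemma Tp_neq (a b : M) : Tp a (cons_tuple b (nil_tuple M)) -> a <> b.
Proof.
move=> Ta ab; pose v i : term L 2 := Var L i.
pose phi := Imp (Eq (v ord0) (v ord_max)) (Fls L 2).
have ext_phi : extension phi (cons_tuple b (nil_tuple M)) = ~` [set b].
  by apply/seteqP; split.
have : typical_property phi (cons_tuple b (nil_tuple M)); last first.
  by move/Ta; rewrite ext_phi; exact.
have bC_inf : infinite_set (~` [set b]).
  by move=> bC; apply: M_infinite; rewrite -(setvU [set b]) finite_setU.
rewrite /typical_property ext_phi setCK; split.
  have b_image : [set b] = (fun=> b) @` (~` [set b]).
    have [m mb] := infinite_setN0 bC_inf.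
    by apply/seteqP; split=> [_ ->|_ [_ _ <-]//]; exists m.
  by rewrite {1}b_image; exact: card_image_le.
by move=> bC_le; apply: bC_inf; exact: card_le_finite bC_le (finite_set1 b).
Qed.

End Typical.

(** * Tailsets of typical reals *)

Section SecondOrder.

Fixpoint rename_real p q (phi : formula2 p q) :
    forall q', ('I_q -> 'I_q') -> formula2 p q' :=
  match phi in formula2 p q
    return forall q', ('I_q -> 'I_q') -> formula2 p q' with
  | Fls2 p _ => fun q' _ => Fls2 p q'
  | EqN2 _ _ s t => fun q' _ => EqN2 q' s t
  | EqR2 p _ i j => fun _ r => EqR2 p (r i) (r j)
  | Lt2 _ _ s t => fun q' _ => Lt2 q' s t
  | In2 _ _ t i => fun _ r => In2 t (r i)
  | Imp2 _ _ phi psi => fun _ r => Imp2 (rename_real phi r) (rename_real psi r)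
  | AllN2 _ _ phi => fun _ r => AllN2 (rename_real phi r)
  | AllR2 _ _ phi => fun _ r => AllR2 (rename_real phi (lift_var r))
  end.

Lemma sat2_rename_real p q (phi : formula2 p q) q' (r : 'I_q -> 'I_q')
    (v : p.-tuple nat) (w : q'.-tuple real) :
  sat2 (rename_real phi r) v w = sat2 phi v [tuple tnth w (r i) | i < q].
Proof.
elim: phi q' r v w => {p q} [p q|p q s t|p q i j|p q s t|p q t i
  |p q f IHf g IHg|p q f IHf|p q f IHf] q' r v w //=.
- by rewrite !tnth_mktuple.
- by rewrite !tnth_mktuple.
- by rewrite IHf IHg.
- by apply: eq_forall => k; rewrite IHf.
- by apply: eq_forall => x; rewrite IHf reindex_cons.
Qed.

Definition Neg2 p q (phi : formula2 p q) : formula2 p q := Imp2 phi (Fls2 p q).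

Definition Iff2 p q (phi psi : formula2 p q) : formula2 p q :=
  Neg2 (Imp2 (Imp2 phi psi) (Neg2 (Imp2 psi phi))).

Lemma sat2_AllN p q (phi : formula2 p.+1 q) v w :
  sat2 (AllN2 phi) v w <-> forall k, sat2 phi (cons_tuple k v) w.
Proof. by []. Qed.

Lemma sat2_Iff p q (phi psi : formula2 p q) v w :
  sat2 (Iff2 phi psi) v w <-> (sat2 phi v w <-> sat2 psi v w).
Proof.
rewrite /Iff2 /=.
by have := conj (EM (sat2 phi v w)) (EM (sat2 psi v w)); tauto.
Qed.

Fixpoint numeral p (k : nat) : term2 p :=
  if k is k'.+1 then NAdd (numeral p k') (NOne p) else NZero p.

Lemma teval2_numeral p (v : p.-tuple nat) k : teval2 v (numeral p k) = k.
Proof. by elim: k => //= k ->; rewrite addn1. Qed.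

Fixpoint among p q (t : term2 p) (s : seq nat) : formula2 p q :=
  if s is k :: s' then Imp2 (Neg2 (EqN2 q t (numeral p k))) (among q t s')
  else Fls2 p q.

Lemma sat2_among p q (t : term2 p) (s : seq nat) v (w : q.-tuple real) :
  sat2 (among q t s) v w <-> teval2 v t \in s.
Proof.
elim: s => //= k s IH; rewrite in_cons teval2_numeral IH.
split=> [h|/orP[/eqP|]//].
by have [->|/eqP/h ->] := eqVneq (teval2 v t) k; rewrite ?eqxx ?orbT.
Qed.

Lemma eq_setY (T : Type) (x d y : set T) :
  y = x `+` d <-> forall n, y n <-> (x n <-> ~ d n).
Proof.
split=> [-> n|yE].
  by rewrite /setY /=; have := conj (EM (x n)) (EM (d n)); tauto.
apply/seteqP; split=> n; rewrite /setY /=;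
  by have := conj (conj (EM (x n)) (EM (d n))) (yE n); tauto.
Qed.

(** Defines y = x + d for d the set of the entries of [s], with y and x the real
    variables of index 0 and 1, through the criterion [eq_setY]. *)
Definition shift_graph q (s : seq nat) : formula2 0 q.+2 :=
  let n := NVar (ord0 : 'I_1) in
  AllN2 (Iff2 (In2 n ord0)
    (Iff2 (In2 n (lift ord0 ord0)) (Neg2 (among q.+2 n s)))).

Lemma sat2_shift_graph q (s : seq nat) v (b : q.-tuple real) x y :
  sat2 (shift_graph q s) v (cons_tuple y (cons_tuple x b)) <->
  y = x `+` [set` s].
Proof.
rewrite eq_setY /shift_graph sat2_AllN.
by split=> h n; move: (h n); rewrite !sat2_Iff /= sat2_among /= tnthS !tnth0.
Qed.

(** Expresses phi(x + d) as: every y equal to x + d satisfies phi.  The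
    quantifier on y places x between the argument of [phi] and its parameters,
    so the indices of the latter are raised by one. *)
Definition shift_formula q (s : seq nat) (phi : formula2 0 q.+1) :
    formula2 0 q.+1 :=
  AllR2 (Imp2 (shift_graph q s) (rename_real phi (lift_var (lift ord0)))).

Lemma extension2_shift q (s : seq nat) (phi : formula2 0 q.+1) b x :
  extension2 (shift_formula s phi) b x <-> extension2 phi b (x `+` [set` s]).
Proof.
have phiE y : sat2 (rename_real phi (lift_var (lift ord0))) (nil_tuple nat)
    (cons_tuple y (cons_tuple x b)) = extension2 phi b y.
  by rewrite sat2_rename_real reindex_cons reindex_behead.
split=> [h|h y /sat2_shift_graph ->]; last by move: h; rewrite -phiE.
by rewrite -phiE; apply: h; apply/sat2_shift_graph.
Qed.

Lemma Tp2_tailset n (c : n.-tuple real) : tailset [set x | Tp2 x c].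
Proof.
move=> a b Ta /finite_seqP[s ds] phi phib.
have shiftK (x : real) : (x `+` [set` s]) `+` [set` s] = x.
  by rewrite -setYA setYK setY0.
have bE : b = a `+` [set` s] by rewrite -ds setYC -setYA setYK setY0.
have /Ta : extension2 (shift_formula s phi) c a.
  by apply/extension2_shift; rewrite -bE.
suff -> : extension2 phi c =
    (fun x => x `+` [set` s]) @` extension2 (shift_formula s phi) c.
  apply: card_eq_trans; apply: inj_card_eq => x y _ _ xy.
  by rewrite -(shiftK x) -(shiftK y); congr (_ `+` _).
apply/seteqP; split=> [x phix|_ [x /extension2_shift phix <-]//].
by exists (x `+` [set` s]) => //; apply/extension2_shift; rewrite shiftK.
Qed.

End SecondOrder.

Theorem proposition3p2 :
  (forall (L : language) (M : structure L), infinite_set [set: M] ->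
     (* (T1) *)
     (cofinality_gt M (language_size L) ->
        (forall (n : nat) (y : n.-tuple M), exists x : M, Tp x y) /\
        (exists a : M, Tp a (nil_tuple M))) /\
     (* (T2) *)
     (forall (a c : M) (n : nat) (b : n.-tuple M),
        Tp a (cons_tuple c b) -> Tp a b) /\
     (* (T3) (a) *)
     (forall (a : M) (n : nat) (b : n.-tuple M) (s : 'S_n),
        Tp a b -> Tp a [tuple tnth b (s i) | i < n]) /\
     (* (T3) (b) *)
     (forall (a b : M) (n : nat) (c : n.-tuple M),
        Tp a (cons_tuple b c) -> Tp a (cons_tuple b (cons_tuple b c))) /\
     (* (T4) *)
     (forall a b : M, Tp a (cons_tuple b (nil_tuple M)) -> a <> b)) /\
  (* (T7) *)
  (forall (n : nat) (c : n.-tuple real), tailset [set x | Tp2 x c]).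
Proof.
split=> [L M M_inf|]; last exact: Tp2_tailset.
split=> [cofM|]; first by split=> [n y|]; exact: exists_Tp.
split=> [a c n b Ta|].
  by rewrite -(reindex_behead c b); exact: Tp_reindex.
split=> [a n b s|]; first exact: Tp_reindex.
split=> [a b n c Ta|]; last exact: Tp_neq.
(* Both copies of b are read off the first entry of the shorter tuple. *)
pose r (i : 'I_n.+2) : 'I_n.+1 := odflt ord0 (unlift ord0 i).
suff <- : [tuple tnth (cons_tuple b c) (r i) | i < n.+2] =
          cons_tuple b (cons_tuple b c) by exact: Tp_reindex.
apply: eq_from_tnth => i; rewrite tnth_mktuple /r.
by case: unliftP => [j ->|->] /=; rewrite ?tnthS // !tnth0.
Qed.
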